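(* Let $a,b,c>0$ with $a>b$, and let $M_0$ be the ellipsoid $\frac{x^2}{a}+\frac{y^2}{b}+\frac{z^2}{c}=1$ in $\mathbb{R}^3$ with the metric induced from the Minkowski metric $dx^2+dy^2-dz^2$. Describe a time-like geodesic of $M_0$ by the coordinates $(t,\alpha)$, where $(\sqrt a\cos t,\sqrt b\sin t,0)$, $t\in\mathbb{R}/2\pi\mathbb{Z}$, is its intersection point with the equator $\{z=0\}\cap M_0$ and $\alpha\in(\pi/4,3\pi/4)$ is its Euclidean angle with the equator at that point. Put $f(t)=\sqrt{a\sin^2t+b\cos^2t}$ and $\tau=\frac{1}{\sqrt{\tan^2\alpha-1}}$ (for $\alpha=\pi/2$ the value of $\tau$ is well-defined: $\tau=0$). Then the Joachimsthal integral $J$ and the area form $\omega$ on the space of time-like geodesics are given by $$J(t,\alpha)=\frac{c\tau^2+f^2(t)(1+\tau^2)}{abc},\qquad \omega=f(t)\,d\tau\wedge dt.$$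
   Context: A geodesic $\gamma$ of $M_0$ is time-like if $\langle\gamma',\gamma'\rangle<0$, where $\langle\cdot,\cdot\rangle$ is the Minkowski metric $dx^2+dy^2-dz^2$. Time-like geodesics lie in the part of $M_0$ where $\frac{x^2}{a^2}+\frac{y^2}{b^2}-\frac{z^2}{c^2}>0$ and cross the equator. The geodesic with coordinates $(t,\alpha)$ has, at its intersection with the equator, the tangent vector $(-\sqrt a\sin t,\sqrt b\cos t,f(t)\tan\alpha)$ (a vertical vector when $\alpha=\pi/2$), and this vector is normalized to have squared length $-1$. The Joachimsthal integral of a geodesic is the (constant along the geodesic) value of $$J=\left(\frac{x^2}{a^2}+\frac{y^2}{b^2}-\frac{z^2}{c^2}\right)\left(\frac{u^2}{a}+\frac{v^2}{b}+\frac{w^2}{c}\right),$$ where $(u,v,w)=\gamma'$ is the velocity, normalized by $u^2+v^2-w^2=-1$, at the point $(x,y,z)$ of $\gamma$. The area form $\omega$ on the space of time-like geodesics is obtained by symplectic reduction: identify the cotangent and tangent bundles of $M_0$ by the metric, so that the canonical symplectic form becomes the restriction of $du\wedge dx+dv\wedge dy-dw\wedge dz$; restrict it to the hypersurface $u^2+v^2-w^2=-1$ and quotient out the one-dimensional kernel of this restriction. In the coordinates $(t,\alpha)$, $\omega$ is the pull-back of $du\wedge dx+dv\wedge dy-dw\wedge dz$ under the map sending $(t,\alpha)$ to the equator point and the normalized velocity there.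
   Formalization: Since τ has a corner and the lifted velocity jumps at α=π/2, the formula for ω is stated literally only for α≠π/2; on all of (π/4,3π/4) it is stated with geodesics oriented upward, so that velocity and τ change sign for α>π/2. *)

(* Defs.v *)
From HB Require Import structures.
From mathcomp Require Import all_boot all_order all_algebra.
From mathcomp Require Import all_classical all_reals all_analysis.

Set Implicit Arguments.
Unset Strict Implicit.
Unset Printing Implicit Defensive.

Import Order.TTheory GRing.Theory Num.Theory.
Import numFieldNormedType.Exports.

Local Open Scope classical_set_scope.
Local Open Scope ring_scope.

Notation vec3 R := (R * R * R)%type.

Section Ellipsoid.
Context {R : realType}.
Implicit Types (p q u v : vec3 R) (t alpha s : R).

Definition cx p : R := p.1.1.
Definition cy p : R := p.1.2.
Definition cz p : R := p.2.

Definition mink u v : R := cx u * cx v + cy u * cy v - cz u * cz v.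

(* For u time-like, the positive multiple of u of squared length -1. *)
Definition normalize u : vec3 R := (Num.sqrt (- mink u u))^-1 *: u.

Variables a b c : R.

Definition ellipsoid : set (vec3 R) :=
  [set p | cx p ^+ 2 / a + cy p ^+ 2 / b + cz p ^+ 2 / c = 1].

Definition tangent_space p : set (vec3 R) :=
  [set v | cx p * cx v / a + cy p * cy v / b + cz p * cz v / c = 0].

(* The Levi-Civita connection of the induced metric is the tangential part of
   the flat connection of Minkowski space, so the geodesic equation says that
   the acceleration is Minkowski-orthogonal to the ellipsoid. *)
Definition geodesic (I : set R) (g : R -> vec3 R) : Prop :=
  [/\ open I, is_interval I &
      forall s, I s ->
        [/\ ellipsoid (g s), derivable g s 1, derivable (derive1 g) s 1 &
            forall v, tangent_space (g s) v -> mink (derive1 (derive1 g) s) v = 0]].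

Definition timelike_geodesic (I : set R) (g : R -> vec3 R) : Prop :=
  geodesic I g /\ forall s, I s -> mink (derive1 g s) (derive1 g s) < 0.

Definition joachimsthal p u : R :=
  (cx p ^+ 2 / a ^+ 2 + cy p ^+ 2 / b ^+ 2 - cz p ^+ 2 / c ^+ 2) *
  (cx u ^+ 2 / a + cy u ^+ 2 / b + cz u ^+ 2 / c).

Definition equator_point t : vec3 R :=
  (Num.sqrt a * cos t, Num.sqrt b * sin t, 0).

Definition eqf t : R := Num.sqrt (a * sin t ^+ 2 + b * cos t ^+ 2).

(* tan (pi / 2) is a junk value, hence the case distinction here and in tau. *)
Definition equator_tangent t alpha : vec3 R :=
  if alpha == pi / 2 then (0, 0, 1)
  else (- (Num.sqrt a * sin t), Num.sqrt b * cos t, eqf t * tan alpha).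

Definition tau alpha : R :=
  if alpha == pi / 2 then 0 else (Num.sqrt (tan alpha ^+ 2 - 1))^-1.

(* The angle describes an unoriented tangent line, hence the free scalar k. *)
Definition has_coordinates (g : R -> vec3 R) s t alpha : Prop :=
  g s = equator_point t /\
  exists2 k : R, k != 0 & derive1 g s = k *: equator_tangent t alpha.

(* Phase space consists of pairs (position, velocity); the chart point
   is (t, alpha). *)
Definition equator_lift (ta : R * R) : vec3 R * vec3 R :=
  (equator_point ta.1, normalize (equator_tangent ta.1 ta.2)).

(* equator_tangent points to z > 0 for alpha <= pi / 2 and to z < 0 for
   alpha > pi / 2, so equator_lift jumps at alpha = pi / 2, where moreover
   tau = |cot alpha| / sqrt (1 - cot alpha ^ 2) has a corner.  Orienting all
   geodesics towards z > 0 reverses velocity and sign of tau together for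
   alpha > pi / 2, and makes both smooth across alpha = pi / 2. *)
Definition orientation alpha : R := if alpha <= pi / 2 then 1 else -1.

Definition upward_lift (ta : R * R) : vec3 R * vec3 R :=
  (equator_point ta.1,
   orientation ta.2 *: normalize (equator_tangent ta.1 ta.2)).

Definition upward_tau alpha : R := orientation alpha * tau alpha.

End Ellipsoid.

Section Forms.
Context {R : realType}.

Definition wedge (V : Type) (th et : V -> R) (X Y : V) : R :=
  th X * et Y - th Y * et X.

(* du /\ dx + dv /\ dy - dw /\ dz *)
Definition canonical_form (X Y : vec3 R * vec3 R) : R :=
  wedge (fun Z => cx Z.2) (fun Z => cx Z.1) X Y
  + wedge (fun Z => cy Z.2) (fun Z => cy Z.1) X Y
  - wedge (fun Z => cz Z.2) (fun Z => cz Z.1) X Y.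

Definition pullback (V W : normedModType R) (F : V -> W) (Om : W -> W -> R)
  (p : V) (X Y : V) : R := Om ('d F p X) ('d F p Y).

End Forms.

(* Main.v *)
(** With s = cos alpha / sqrt (sin^2 alpha - cos^2 alpha), a smooth function on
    the whole range of alpha, the upward unit tangent at the equator is
    (- s sqrt a sin t / f, s sqrt b cos t / f, sqrt (1 + s^2)), and s is tau up
    to the sign of cos alpha.  Evaluating J there is algebra, and in the
    pull-back of the canonical form only the terms ds /\ dt survive, with
    coefficient (a sin^2 t + b cos^2 t) / f = f.

    Along a geodesic g'' = l n with n the Minkowski normal (x/a, y/b, - z/c).
    Write B(u, v, w) = u^2/a + v^2/b + w^2/c.  Differentiating the equation of the
    ellipsoid twice gives l <n, n> = - B(g'), hence <n, n> B(g') has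
    derivative 2 (B(g') + l <n, n>) <n, n'> = 0. *)

Require Import Defs.
From HB Require Import structures.
From mathcomp Require Import all_boot all_order all_algebra.
From mathcomp Require Import all_classical all_reals all_analysis.
From mathcomp Require Import ring lra.

Set Implicit Arguments.
Unset Strict Implicit.
Unset Printing Implicit Defensive.

Import Order.TTheory GRing.Theory Num.Theory.
Import numFieldNormedType.Exports.

Local Open Scope classical_set_scope.
Local Open Scope ring_scope.

(** * Differential calculus on the chart and on curves *)

Lemma near_eq_is_diff (R : realType) (V W : normedModType R) (f g df : V -> W)
    (x : V) :
  (\near x, f x = g x) -> is_diff x f df -> is_diff x g df.
Proof.
move=> fg [dfx <-].
have fgx : f x = g x := nbhs_singleton fg.
(* Only values near [x] enter the first-order expansion, so that of [f] is also one of [g];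
   uniqueness of the differential then identifies the two. *)
have gE : g \o shift x = cst (g x) + 'd f x +o_ 0 id.
  apply/eqaddoP => _/posnumP[e].
  have /eqaddoP/(_ _ (gt0 e)) := diff_locally dfx.
  have : \forall h \near (0 : V), f (h + x) = g (h + x).
    by rewrite (near_shift x) sub0r; near do rewrite /= subrK.
  apply: filterS2 => h fgh.
  by rewrite -![(_ - _) _]/(_ - _) /= -![(_ + _) _]/(_ + _) /= -fgh -fgx.
have dg : 'd g x = 'd f x :> (V -> W).
  by apply: diff_unique => //; exact: diff_continuous.
split => //; apply/diff_locallyP; rewrite dg; split => //.
exact: diff_continuous.
Unshelve. all: by end_near. Qed.

Lemma is_derive_is_diff (R : realType) (f : R -> R) (x df : R) :
  is_derive x 1 f df -> is_diff x f (fun h => h * df).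
Proof.
move=> [fx <-]; split; first exact/derivable1_diffP.
by rewrite deriv1E// derive1E.
Qed.

Lemma is_diff_fst (R : realType) (p : R * R) : is_diff p fst fst.
Proof.
have fst_lin : linear (fst : R * R -> R) by [].
(* Packed as a continuous linear map, the projection is its own differential. *)
pose L : {linear (R * R)%type -> R} :=
  HB.pack (fst : R * R -> R) (GRing.isLinear.Build _ _ _ _ _ fst_lin).
have Lc : continuous L by move=> x; exact: cvg_fst.
split; first exact: (@linear_differentiable _ _ _ L p).
exact: (@diff_lin _ _ _ L p).
Qed.

Lemma is_diff_snd (R : realType) (p : R * R) : is_diff p snd snd.
Proof.
have snd_lin : linear (snd : R * R -> R) by [].
pose L : {linear (R * R)%type -> R} :=
  HB.pack (snd : R * R -> R) (GRing.isLinear.Build _ _ _ _ _ snd_lin).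
have Lc : continuous L by move=> x; exact: cvg_snd.
split; first exact: (@linear_differentiable _ _ _ L p).
exact: (@diff_lin _ _ _ L p).
Qed.

Lemma is_diff_comp_fst (R : realType) (f : R -> R) (p : R * R) (df : R) :
  is_derive p.1 1 f df -> is_diff p (fun q => f q.1) (fun X => X.1 * df).
Proof.
move=> /is_derive_is_diff fp; have fstp := is_diff_fst p.
exact: (is_diff_comp fstp fp).
Qed.

Lemma is_diff_comp_snd (R : realType) (f : R -> R) (p : R * R) (df : R) :
  is_derive p.2 1 f df -> is_diff p (fun q => f q.2) (fun X => X.2 * df).
Proof.
move=> /is_derive_is_diff fp; have sndp := is_diff_snd p.
exact: (is_diff_comp sndp fp).
Qed.

Lemma is_diff_mul_fst_snd (R : realType) (f g : R -> R) (p : R * R)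
    (df dg : R) :
  is_derive p.1 1 f df -> is_derive p.2 1 g dg ->
  is_diff p (fun q => f q.1 * g q.2)
            (fun X => f p.1 * (X.2 * dg) + g p.2 * (X.1 * df)).
Proof.
move=> /is_diff_comp_fst fp /is_diff_comp_snd gp.
exact: (is_diffM fp gp).
Qed.

Lemma derivable_sqrt_comp (R : realType) (f : R -> R) (x : R) :
  0 < f x -> derivable f x 1 -> derivable (fun y => Num.sqrt (f y)) x 1.
Proof.
move=> fx0 /derivable1_diffP df; apply/derivable1_diffP.
apply: (@differentiable_comp _ _ _ _ f Num.sqrt) => //.
by apply/derivable1_diffP; have [] := is_derive1_sqrt fx0.
Qed.

Lemma sum3_sqr_eq0 (R : realDomainType) (x y z : R) :
  x ^+ 2 + y ^+ 2 + z ^+ 2 = 0 -> [/\ x = 0, y = 0 & z = 0].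
Proof.
move/eqP; rewrite !paddr_eq0 ?addr_ge0 ?sqr_ge0// !sqrf_eq0.
by move=> /andP[/andP[/eqP-> /eqP->] /eqP->].
Qed.

Lemma eq_on_interval_derive0 (R : realType) (I : set R) (f : R -> R) :
  is_interval I -> (forall s, I s -> is_derive s 1 f 0) ->
  forall s s', I s -> I s' -> f s = f s'.
Proof.
move=> itvI f0 s s'.
wlog ss' : s s' / s <= s'.
  by move=> H; case: (leP s s') => [/H//|/ltW/H H' Is Is']; exact/esym/H'.
move=> Is Is'.
have sI x : x \in `[s, s'] -> I x.
  by rewrite in_itv /= => xss'; exact: (itvI _ _ Is Is').
have [||_ _] := @MVT_segment R f (fun=> 0) s s' ss'.
- by move=> x xss'; apply/f0/sI/subset_itv_oo_cc.
- by apply: derivable_within_continuous => x /sI/f0[].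
- by rewrite mul0r => /eqP; rewrite subr_eq0 => /eqP.
Qed.

Lemma is_derive_linear (R : realType) (V W : normedModType R)
    (L : {linear V -> W}) (f : R -> V) (s : R) :
  continuous L -> derivable f s 1 -> is_derive s 1 (L \o f) (L (derive1 f s)).
Proof.
move=> Lc /derivable1_diffP fs.
have Lf : differentiable L (f s) by exact: linear_differentiable.
have Lfs : differentiable (L \o f) s by exact: differentiable_comp.
split; first exact/derivable1_diffP.
by rewrite deriveE// diff_comp//= diff_lin// derive1E deriveE.
Qed.

(** * Product rule for diagonal bilinear forms along curves *)

Section Coordinates.
Context {R : realType}.
Implicit Types (f : R -> vec3 R) (s : R).

Lemma is_derive_cx f s : derivable f s 1 ->
  is_derive s 1 (cx \o f) (cx (derive1 f s)).
Proof.
have lin : linear (cx : vec3 R -> R) by [].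
pose L : {linear vec3 R -> R} :=
  HB.pack (cx : vec3 R -> R) (GRing.isLinear.Build _ _ _ _ _ lin).
apply: (@is_derive_linear _ _ _ L) => x.
by apply: (cvg_comp _ _ cvg_fst); exact: cvg_fst.
Qed.

Lemma is_derive_cy f s : derivable f s 1 ->
  is_derive s 1 (cy \o f) (cy (derive1 f s)).
Proof.
have lin : linear (cy : vec3 R -> R) by [].
pose L : {linear vec3 R -> R} :=
  HB.pack (cy : vec3 R -> R) (GRing.isLinear.Build _ _ _ _ _ lin).
apply: (@is_derive_linear _ _ _ L) => x.
by apply: (cvg_comp _ _ cvg_fst); exact: cvg_snd.
Qed.

Lemma is_derive_cz f s : derivable f s 1 ->
  is_derive s 1 (cz \o f) (cz (derive1 f s)).
Proof.
have lin : linear (cz : vec3 R -> R) by [].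
pose L : {linear vec3 R -> R} :=
  HB.pack (cz : vec3 R -> R) (GRing.isLinear.Build _ _ _ _ _ lin).
apply: (@is_derive_linear _ _ _ L) => x; exact: cvg_snd.
Qed.

(** This family contains the Minkowski product, the form defining the ellipsoid and the squared
    length of its normal, so one product rule serves all three. *)
Definition diag_form (k l m : R) (u v : vec3 R) : R :=
  k * (cx u * cx v) + l * (cy u * cy v) + m * (cz u * cz v).

Lemma diag_formC (k l m : R) u v : diag_form k l m u v = diag_form k l m v u.
Proof. by rewrite /diag_form (mulrC (cx u)) (mulrC (cy u)) (mulrC (cz u)). Qed.

Lemma is_derive_diag_form (k l m : R) (f g : R -> vec3 R) s :
  derivable f s 1 -> derivable g s 1 ->
  is_derive s 1 (fun r => diag_form k l m (f r) (g r))
    (diag_form k l m (derive1 f s) (g s) + diag_form k l m (f s) (derive1 g s)).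
Proof.
move=> df dg.
have := is_derive_cx df; have := is_derive_cy df; have := is_derive_cz df.
have := is_derive_cx dg; have := is_derive_cy dg; have := is_derive_cz dg.
move=> gz gy gx fz fy fx.
have -> : (fun r => diag_form k l m (f r) (g r)) =
  k *: ((cx \o f) * (cx \o g)) + l *: ((cy \o f) * (cy \o g))
  + m *: ((cz \o f) * (cz \o g)) by [].
have D := is_deriveD (is_deriveD (is_deriveZ k (is_deriveM fx gx))
  (is_deriveZ l (is_deriveM fy gy))) (is_deriveZ m (is_deriveM fz gz)).
apply: (is_derive_eq D); move: (derive1 f s) (derive1 g s) => u v.
rewrite /diag_form /comp -![_ *: _]/(_ * _); move: (f s) (g s) => p q; ring.
Qed.

End Coordinates.

(** * Constancy of the Joachimsthal integral along geodesics *)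

Section Geodesics.
Context {R : realType}.
Variables a b c : R.
Implicit Types (I : set R) (g : R -> vec3 R) (p u v : vec3 R) (s : R).

(** The Minkowski square of the normal (x/a, y/b, -z/c), which is the first factor of J. *)
Definition normal_sq p : R := diag_form (a ^- 2) (b ^- 2) (- c ^- 2) p p.
(** The polarized form B: it expresses the ellipsoid equation, tangency, and the second factor of
    J. *)
Definition shape p v : R := diag_form a^-1 b^-1 c^-1 p v.

Lemma ellipsoidE p : ellipsoid a b c p <-> shape p p = 1.
Proof.
rewrite /ellipsoid /shape /diag_form /= !expr2.
by rewrite ![_^-1 * _]mulrC.
Qed.

Lemma tangent_spaceE p v : tangent_space a b c p v <-> shape p v = 0.
Proof.
rewrite /tangent_space /shape /diag_form /=.
by rewrite ![_^-1 * _]mulrC.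
Qed.

Lemma minkE u v : mink u v = diag_form 1 1 (-1) u v.
Proof. by rewrite /mink /diag_form; ring. Qed.

(** J is quadratic in the velocity, so the square root in [normalize] is squared away. Constancy of
    J thus splits into that of a numerator and that of the speed. *)
Lemma joachimsthal_normalize p v : mink v v < 0 ->
  joachimsthal a b c p (normalize v) = normal_sq p * shape v v / - mink v v.
Proof.
move=> v0.
have sE : (Num.sqrt (- mink v v))^-1 ^+ 2 = (- mink v v)^-1.
  by rewrite exprVn sqr_sqrtr// oppr_ge0 ltW.
rewrite /joachimsthal /normalize /normal_sq /shape /diag_form.
rewrite /cx /cy /cz /= -!/(cx _) -!/(cy _) -!/(cz _).
rewrite -![_ *: _]/(_ * _) !exprMn sE; ring.
Qed.

Lemma mink_scale (k : R) v : mink (k *: v) (k *: v) = k ^+ 2 * mink v v.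
Proof. by rewrite /mink /cx /cy /cz /= -![_ *: _]/(_ * _); ring. Qed.

(** The factor [k ^+ 2] cancels between numerator and denominator, whatever the sign of [k]; this
    absorbs the free scalar of [has_coordinates]. *)
Lemma joachimsthal_normalize_scale (k : R) p v : k != 0 -> mink v v < 0 ->
  joachimsthal a b c p (normalize (k *: v)) =
  joachimsthal a b c p (normalize v).
Proof.
move=> k0 v0.
have k2 : 0 < k ^+ 2 by rewrite exprn_even_gt0.
rewrite !joachimsthal_normalize// ?mink_scale ?pmulr_rlt0//.
have -> : shape (k *: v) (k *: v) = k ^+ 2 * shape v v.
  by rewrite /shape /diag_form /cx /cy /cz /= -![_ *: _]/(_ * _); ring.
by field; rewrite lt_eqF// k0.
Qed.

Section Along.
Variables (I : set R) (g : R -> vec3 R).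
Hypothesis geog : geodesic a b c I g.
Local Notation dg := (derive1 g).
Local Notation ddg := (derive1 (derive1 g)).

Let Inear s : I s -> \forall r \near s, I r.
Proof. by have [oI _ _] := geog => Is; exact: open_nbhs_nbhs. Qed.

Let dgP s : I s -> derivable g s 1.
Proof. by have [_ _ H] := geog => /H[]. Qed.

Let ddgP s : I s -> derivable dg s 1.
Proof. by have [_ _ H] := geog => /H[]. Qed.

(** As [I] is open, the ellipsoid equation holds near [s] and can be differentiated. *)
Lemma geodesic_tangent s : I s -> shape (g s) (dg s) = 0.
Proof.
move=> Is.
have d1 := is_derive_diag_form a^-1 b^-1 c^-1 (dgP Is) (dgP Is).
have d0 : is_derive s 1 (fun r => shape (g r) (g r)) 0.
  apply: (@near_eq_is_derive _ R R (cst 1)).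
  have := Inear Is; apply: filterS => r Ir.
  by apply/esym/ellipsoidE; have [_ _ /(_ _ Ir)[]] := geog.
have := @derive_val _ _ _ _ _ _ _ d1; rewrite (@derive_val _ _ _ _ _ _ _ d0).
by rewrite /shape /diag_form => E; lra.
Qed.

Lemma geodesic_shape_ddg s : I s ->
  shape (dg s) (dg s) + shape (g s) (ddg s) = 0.
Proof.
move=> Is.
have d1 := is_derive_diag_form a^-1 b^-1 c^-1 (dgP Is) (ddgP Is).
have d0 : is_derive s 1 (fun r => shape (g r) (dg r)) 0.
  apply: (@near_eq_is_derive _ R R (cst 0)).
  have := Inear Is; apply: filterS => r Ir.
  exact/esym/geodesic_tangent.
have := @derive_val _ _ _ _ _ _ _ d1; rewrite (@derive_val _ _ _ _ _ _ _ d0).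
by rewrite /shape.
Qed.

(** The Minkowski product with (u, v, w) is the Euclidean product with A = (u, v, -w). Subtracting
    from A its Euclidean projection on the gradient N = (x', y', z') leaves a tangent vector; it is
    orthogonal to both A and N, hence to itself, so A = l N. *)
Lemma geodesic_acceleration s : I s -> exists l : R,
  ddg s = l *: (cx (g s) / a, cy (g s) / b, - (cz (g s) / c)).
Proof.
move=> Is; have [_ _ /(_ _ Is)[/ellipsoidE gE _ _ orth]] := geog.
move: (g s) (ddg s) gE orth => [[x y] z] [[u v] w].
rewrite /shape /diag_form /cx /cy /cz /= => gE orth.
set x' := x / a; set y' := y / b; set z' := z / c.
(* The gradient pairs to 1 with the point, so its Euclidean square is nonzero. The Minkowski square
   of the normal can vanish, which is why the projection is Euclidean. *)
have n0 : x' ^+ 2 + y' ^+ 2 + z' ^+ 2 != 0.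
  apply/eqP => /sum3_sqr_eq0[x0 y0 z0].
  have : x' * x + y' * y + z' * z = 1 by rewrite -gE /x' /y' /z'; ring.
  by rewrite x0 y0 z0 !mul0r !addr0 => /esym/eqP; rewrite oner_eq0.
pose l := (u * x' + v * y' - w * z') / (x' ^+ 2 + y' ^+ 2 + z' ^+ 2).
have lE : l * (x' ^+ 2 + y' ^+ 2 + z' ^+ 2) = u * x' + v * y' - w * z'.
  by rewrite divfK.
exists l.
have tan0 : x' * (u - l * x') + y' * (v - l * y') + z' * (- w - l * z') = 0.
  move/eqP: lE; rewrite -subr_eq0 => /eqP E.
  by rewrite -[LHS]opprK -oppr0 -[in RHS]E; ring.
have := orth (u - l * x', v - l * y', - w - l * z').
rewrite /tangent_space /mink /cx /cy /cz /= => /(_ _) E.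
have {}E : u * (u - l * x') + v * (v - l * y') - w * (- w - l * z') = 0.
  by apply: E; rewrite -[RHS]tan0 /x' /y' /z'; ring.
have {E} : (u - l * x') ^+ 2 + (v - l * y') ^+ 2 + (- w - l * z') ^+ 2 = 0.
  rewrite -[RHS](subr0 0) -[X in _ = X - _]E -[X in _ = _ - X](mulr0 l).
  by rewrite -[X in _ = _ - l * X]tan0; ring.
move=> /sum3_sqr_eq0[ux vy wz].
have -> : u = l * x' by apply/eqP; rewrite -subr_eq0 ux.
have -> : v = l * y' by apply/eqP; rewrite -subr_eq0 vy.
have -> // : w = l * (- z').
by rewrite mulrN -[w]opprK; apply/eqP; rewrite eqr_opp -subr_eq0 wz.
Qed.

Lemma geodesic_mink_cst s s' : I s -> I s' ->
  mink (dg s) (dg s) = mink (dg s') (dg s').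
Proof.
have [_ itvI geo] := geog.
apply: (eq_on_interval_derive0 (f := fun r => mink (dg r) (dg r)) itvI) => r Ir.
have -> : (fun r => mink (dg r) (dg r)) =
          (fun r => diag_form 1 1 (-1) (dg r) (dg r)).
  by apply/funext => q; exact: minkE.
apply: is_derive_eq; first exact: is_derive_diag_form (ddgP Ir) (ddgP Ir).
(* The velocity is itself tangent, so it may serve as test vector in the geodesic equation. *)
have [_ _ _ /(_ (dg r))] := geo _ Ir.
rewrite minkE => /(_ _)E.
have {}E : diag_form 1 1 (-1) (ddg r) (dg r) = 0.
  by apply: E; apply/tangent_spaceE; exact: geodesic_tangent.
by rewrite [X in _ + X]diag_formC E addr0.
Qed.

Lemma geodesic_joachimsthal_cst s s' : I s -> I s' ->
  normal_sq (g s) * shape (dg s) (dg s) =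
  normal_sq (g s') * shape (dg s') (dg s').
Proof.
have [_ itvI geo] := geog.
apply: (eq_on_interval_derive0
  (f := fun r => normal_sq (g r) * shape (dg r) (dg r)) itvI) => r Ir.
have dA := is_derive_diag_form (a ^- 2) (b ^- 2) (- c ^- 2) (dgP Ir) (dgP Ir).
have dB := is_derive_diag_form a^-1 b^-1 c^-1 (ddgP Ir) (ddgP Ir).
apply: (@is_derive_eq _ R R _ _ _ _ _ (is_deriveM dA dB)).
have [l lE] := geodesic_acceleration Ir.
have := geodesic_shape_ddg Ir.
rewrite -![_ *: _]/(_ * _) lE.
move: (g r) (dg r) => [[x y] z] [[u v] w].
rewrite /shape /diag_form /cx /cy /cz /= -![_ *: _]/(_ * _) => E.
(* [S] is the Minkowski product of the normal with its derivative; the two factors have derivatives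
   2 S and 2 l S, so the total is 2 S times the left side of [E]. *)
pose S := x * u / a ^+ 2 + y * v / b ^+ 2 - z * w / c ^+ 2.
rewrite -[RHS](mulr0 (2 * S)) -[in RHS]E /S -!exprVn; ring.
Qed.

End Along.

Lemma timelike_geodesic_joachimsthal I g s s' :
  timelike_geodesic a b c I g -> I s -> I s' ->
  joachimsthal a b c (g s) (normalize (derive1 g s)) =
  joachimsthal a b c (g s') (normalize (derive1 g s')).
Proof.
move=> [geo tl] Is Is'.
rewrite (joachimsthal_normalize _ (tl _ Is)).
rewrite (joachimsthal_normalize _ (tl _ Is')).
exact: (f_equal2 (fun x y => x / - y)
  (geodesic_joachimsthal_cst geo Is Is') (geodesic_mink_cst geo Is Is')).
Qed.

End Geodesics.

(** * Time-like angles and the normalized tangent at the equator *)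

Section EquatorLift.
Context {R : realType}.
Variables a b : R.
Hypotheses (a0 : 0 < a) (b0 : 0 < b).
Implicit Types (t alpha : R).

Lemma eqf_sq_gt0 t : 0 < a * sin t ^+ 2 + b * cos t ^+ 2.
Proof.
have [s0|s0] := eqVneq (sin t) 0.
  have := cos2Dsin2 t; rewrite s0 expr0n/= addr0 => ->.
  by rewrite mulr0 add0r mulr1.
apply: ltr_pwDl; first by rewrite mulr_gt0// exprn_even_gt0.
by rewrite mulr_ge0 ?sqr_ge0// ltW.
Qed.

Lemma eqf_gt0 t : 0 < eqf a b t.
Proof. by rewrite sqrtr_gt0 eqf_sq_gt0. Qed.

Lemma sqr_eqf t : eqf a b t ^+ 2 = a * sin t ^+ 2 + b * cos t ^+ 2.
Proof. by rewrite sqr_sqrtr// ltW// eqf_sq_gt0. Qed.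

(** The difference of squares is cos (2 alpha - pi), whose argument lies strictly between -pi/2 and
    pi/2. *)
Lemma timelike_angle alpha : pi / 4 < alpha < 3 * pi / 4 ->
  0 < sin alpha /\ 0 < sin alpha ^+ 2 - cos alpha ^+ 2.
Proof.
move=> /andP[h1 h2]; have p0 := pi_gt0 R; split.
  by apply: sin_gt0_pi; apply/andP; split; lra.
have : 0 < cos (alpha + alpha - pi).
  by apply: cos_gt0_pihalf; apply/andP; split; lra.
by rewrite cosB cospi sinpi mulr0 addr0 mulrN1 cosD opprB -!expr2.
Qed.

Lemma cos_eq0_timelike alpha : pi / 4 < alpha < 3 * pi / 4 ->
  (cos alpha == 0) = (alpha == pi / 2).
Proof.
move=> /andP[h1 h2]; have p0 := pi_gt0 R; apply/eqP/eqP => [|->]; last first.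
  exact: cos_pihalf.
rewrite -(cos_pihalf R) => /cos_inj.
by apply; rewrite in_itv/=; apply/andP; split; lra.
Qed.

Lemma cos_lt0_timelike alpha : pi / 4 < alpha < 3 * pi / 4 ->
  (cos alpha < 0) = (pi / 2 < alpha).
Proof.
move=> /andP[h1 h2]; have p0 := pi_gt0 R.
rewrite -(cos_pihalf R) ltr_cos// in_itv/=; apply/andP; split; lra.
Qed.

(** The Minkowski length of a Euclidean unit tangent vector at angle [alpha] to the equator. *)
Definition discr alpha : R := Num.sqrt (sin alpha ^+ 2 - cos alpha ^+ 2).

(** The root of tan^2 - 1 is [discr alpha] over |cos alpha|. Away from pi/2 [orientation] is the
    sign of the cosine and removes the absolute value; at pi/2 both sides vanish. *)
Lemma upward_tauE alpha : pi / 4 < alpha < 3 * pi / 4 ->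
  upward_tau alpha = cos alpha / discr alpha.
Proof.
move=> ha; have [s0 d0] := timelike_angle ha.
rewrite /upward_tau /tau -cos_eq0_timelike// /orientation leNgt.
rewrite -cos_lt0_timelike//.
have [->|c0] := eqVneq (cos alpha) 0; first by rewrite mulr0 mul0r.
have -> : tan alpha ^+ 2 - 1 =
    (sin alpha ^+ 2 - cos alpha ^+ 2) / cos alpha ^+ 2.
  by rewrite /tan; field.
rewrite sqrtrM ?ltW// sqrtrV ?sqr_ge0// sqrtr_sqr -/(discr _) invfM invrK mulrC.
case: ltgtP c0 => // cs _ /=.
  by rewrite ltr0_norm// mulrN1 mulrN opprK mulrC.
by rewrite gtr0_norm// mulr1 mulrC.
Qed.

Lemma tauE alpha : pi / 4 < alpha < 3 * pi / 4 ->
  tau alpha = orientation alpha * (cos alpha / discr alpha).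
Proof.
move=> /upward_tauE <-; rewrite /upward_tau mulrA /orientation.
by case: ifP; rewrite ?mulrNN !mul1r.
Qed.

Lemma norm_cos_timelike alpha : pi / 4 < alpha < 3 * pi / 4 ->
  `|cos alpha| = orientation alpha * cos alpha.
Proof.
move=> ha; rewrite /orientation leNgt -cos_lt0_timelike//.
by case: (ltP (cos alpha) 0) => cs /=;
  [rewrite ltr0_norm// mulN1r|rewrite ger0_norm// mul1r].
Qed.

Lemma orientation_neq0 alpha : orientation alpha != 0.
Proof. by rewrite /orientation; case: ifP; rewrite ?oppr_eq0 oner_eq0. Qed.

Lemma orientation_sqr alpha : orientation alpha * orientation alpha = 1.
Proof. by rewrite /orientation; case: ifP; rewrite ?mulrNN mulr1. Qed.

Lemma discr_gt0 alpha : pi / 4 < alpha < 3 * pi / 4 -> 0 < discr alpha.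
Proof. by move=> /timelike_angle[_ d0]; rewrite sqrtr_gt0. Qed.

(** The horizontal part has squared length f^2 and the vertical part is f tan alpha, which gives f^2
    (1 - tan^2 alpha). *)
Lemma mink_equator_tangentE t alpha : pi / 4 < alpha < 3 * pi / 4 ->
  cos alpha != 0 ->
  mink (equator_tangent a b t alpha) (equator_tangent a b t alpha) =
  - (eqf a b t * (discr alpha / cos alpha)) ^+ 2.
Proof.
move=> ha c0; have [_ d0] := timelike_angle ha.
rewrite /equator_tangent -cos_eq0_timelike// (negbTE c0) /mink /cx /cy /cz /=.
rewrite !exprMn exprVn [discr _ ^+ 2]sqr_sqrtr ?ltW//.
have -> : - (Num.sqrt a * sin t) * - (Num.sqrt a * sin t) +
    Num.sqrt b * cos t * (Num.sqrt b * cos t) = eqf a b t ^+ 2.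
  rewrite sqr_eqf -[in RHS](sqr_sqrtr (ltW a0)) -[in RHS](sqr_sqrtr (ltW b0)).
  by ring.
by rewrite /tan; field.
Qed.

Lemma mink_equator_tangent_lt0 t alpha : pi / 4 < alpha < 3 * pi / 4 ->
  mink (equator_tangent a b t alpha) (equator_tangent a b t alpha) < 0.
Proof.
move=> ha; have [c0|c0] := eqVneq (cos alpha) 0; last first.
  rewrite mink_equator_tangentE// oppr_lt0 exprn_even_gt0//=.
  by rewrite !mulf_neq0 ?invr_eq0// lt0r_neq0 ?eqf_gt0 ?discr_gt0.
rewrite /equator_tangent -cos_eq0_timelike// c0 eqxx /mink /cx /cy /cz /=.
by rewrite mulr0 addr0 sub0r mulr1 oppr_lt0.
Qed.

(** The orientation enters as a constant [o], so that one differentiation covers both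
    [equator_lift], where it is locally constant off pi/2, and [upward_lift], where [o] is 1. *)
Definition chart_lift (o : R) (q : R * R) : vec3 R * vec3 R :=
  (equator_point a b q.1,
   (- (Num.sqrt a * sin q.1) / eqf a b q.1 * (o * (cos q.2 / discr q.2)),
    Num.sqrt b * cos q.1 / eqf a b q.1 * (o * (cos q.2 / discr q.2)),
    o * (sin q.2 / discr q.2))).

Lemma equator_liftE t alpha : pi / 4 < alpha < 3 * pi / 4 ->
  equator_lift a b (t, alpha) = chart_lift (orientation alpha) (t, alpha).
Proof.
move=> ha; have [s0 d0] := timelike_angle ha.
have f0 := lt0r_neq0 (eqf_gt0 t); have dn0 := lt0r_neq0 (discr_gt0 ha).
have o0 := orientation_neq0 alpha.
rewrite /equator_lift /chart_lift /=; congr (_, _).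
(* At pi/2 the tangent is (0, 0, 1) by definition, already of squared length -1, so this case is
   checked by evaluation. *)
have [c0|c0] := eqVneq (cos alpha) 0.
  have s1 : sin alpha = 1.
    move: c0 => /eqP; rewrite cos_eq0_timelike// => /eqP ->.
    exact: sin_pihalf.
  have -> : orientation alpha = 1.
    by rewrite /orientation leNgt -cos_lt0_timelike// c0 ltxx.
  rewrite /normalize /equator_tangent -cos_eq0_timelike// c0 eqxx.
  have -> : mink (0, 0, 1) (0, 0, 1) = -1 :> R.
    by rewrite /mink /cx /cy /cz /= mulr0 addr0 sub0r mulr1.
  have -> : discr alpha = 1.
    by rewrite /discr c0 s1 expr1n expr0n/= subr0 sqrtr1.
  by rewrite s1 opprK sqrtr1 invr1 scale1r mul0r !mulr0 !mulr1.
rewrite /normalize mink_equator_tangentE// opprK sqrtr_sqr normrM.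
rewrite normrM normfV norm_cos_timelike// !gtr0_norm ?eqf_gt0 ?discr_gt0//.
have oo := orientation_sqr alpha.
have kE : (eqf a b t * (discr alpha / (orientation alpha * cos alpha)))^-1 =
    orientation alpha * (cos alpha / discr alpha) / eqf a b t.
  by field; rewrite o0 c0 dn0 f0.
rewrite kE /equator_tangent -cos_eq0_timelike// (negbTE c0).
have scaleE (k x y z : R) : k *: (x, y, z) = (k * x, k * y, k * z) by [].
by rewrite scaleE; congr (_, _, _); rewrite /tan; field; rewrite ?f0 ?dn0 ?c0.
Qed.

Lemma upward_liftE t alpha : pi / 4 < alpha < 3 * pi / 4 ->
  upward_lift a b (t, alpha) = chart_lift 1 (t, alpha).
Proof.
move=> ha.
have E : normalize (equator_tangent a b t alpha) =
    (chart_lift (orientation alpha) (t, alpha)).2 by rewrite -equator_liftE.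
transitivity (equator_point a b t,
  orientation alpha *: normalize (equator_tangent a b t alpha)) => //.
rewrite E /chart_lift [_.1]/= [(t, alpha).2]/= [_.2]/=; congr (_, _).
have scaleE (k x y z : R) : k *: (x, y, z) = (k * x, k * y, k * z) by [].
have oo := orientation_sqr alpha.
rewrite scaleE; congr (_, _, _).
- by rewrite mulrCA [X in _ * X = _]mulrA oo.
- by rewrite mulrCA [X in _ * X = _]mulrA oo.
- by rewrite mulrA oo.
Qed.

(** The position factor is cos^2 t / a + sin^2 t / b = f^2 / (a b), and the velocity factor is tau^2
    / f^2 + (1 + tau^2) / c. *)
Lemma joachimsthal_equator (c t alpha : R) : 0 < c ->
  pi / 4 < alpha < 3 * pi / 4 ->
  joachimsthal a b c (equator_point a b t)
    (normalize (equator_tangent a b t alpha)) =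
  (c * tau alpha ^+ 2 + eqf a b t ^+ 2 * (1 + tau alpha ^+ 2)) / (a * b * c).
Proof.
move=> c0 ha; have [_ d0] := timelike_angle ha.
have -> : normalize (equator_tangent a b t alpha) =
    (chart_lift (orientation alpha) (t, alpha)).2 by rewrite -equator_liftE.
have f0 := lt0r_neq0 (eqf_gt0 t); have dn0 := lt0r_neq0 (discr_gt0 ha).
have w2 : (orientation alpha * (sin alpha / discr alpha)) ^+ 2 =
    1 + tau alpha ^+ 2.
  rewrite tauE// !exprMn exprVn [orientation _ ^+ 2]expr2.
  rewrite orientation_sqr !mul1r.
  rewrite (_ : sin alpha ^+ 2 = discr alpha ^+ 2 + cos alpha ^+ 2).
    by rewrite mulrDl divff// expf_neq0.
  by rewrite [discr _ ^+ 2]sqr_sqrtr ?subrK// ltW.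
rewrite /joachimsthal /chart_lift /equator_point /cx /cy /cz [_.2]/=.
rewrite [(t, alpha).1]/= [(t, alpha).2]/= -tauE// [in LHS]/= w2.
move: (tau alpha) => T; rewrite !exprMn !sqrrN !exprMn.
rewrite !exprVn sqr_eqf (sqr_sqrtr (ltW a0)) (sqr_sqrtr (ltW b0)) sin2cos2.
have := eqf_sq_gt0 t; rewrite sin2cos2 => /lt0r_neq0 F0.
by field; rewrite F0 !lt0r_neq0.
Qed.

(** * Pull-back of the canonical form to the chart *)

Lemma derivable_eqf t : derivable (eqf a b) t 1.
Proof.
apply: (@derivable_sqrt_comp _ (fun t => a * sin t ^+ 2 + b * cos t ^+ 2)).
  exact: eqf_sq_gt0.
by [].
Qed.

Lemma derivable_discr alpha : pi / 4 < alpha < 3 * pi / 4 ->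
  derivable discr alpha 1.
Proof.
move=> /timelike_angle[_ d0].
exact: (@derivable_sqrt_comp _ (fun x => sin x ^+ 2 - cos x ^+ 2)).
Qed.

Lemma chart_lift_form (o : R) (p : R * R)
    (h := fun al => o * (cos al / discr al)) :
  pi / 4 < p.2 < 3 * pi / 4 ->
  [/\ differentiable (chart_lift o) p, derivable h p.2 1 &
      forall X Y : R * R, pullback (chart_lift o) canonical_form p X Y =
        eqf a b p.1 * (X.2 * derive1 h p.2 * Y.1 - Y.2 * derive1 h p.2 * X.1)].
Proof.
move=> hp; have f0 := lt0r_neq0 (eqf_gt0 p.1).
have dV : derivable (fun al => (discr al)^-1) p.2 1.
  apply: (@derivableV _ _ discr _ _ (lt0r_neq0 (discr_gt0 hp))).
  exact: derivable_discr.
have fV : derivable (fun t => (eqf a b t)^-1) p.1 1.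
  exact: (@derivableV _ _ (eqf a b) _ _ f0 (@derivable_eqf p.1)).
have hD : derivable h p.2 1.
  exact: (derivableM (@derivable_cst R R R o _ 1)
                     (derivableM (@derivable_cos R _) dV)).
have wD : derivable (fun al => o * (sin al / discr al)) p.2 1.
  exact: (derivableM (@derivable_cst R R R o _ 1)
                     (derivableM (@derivable_sin R _) dV)).
have xD : is_derive p.1 1 (fun t => Num.sqrt a * cos t)
    (- (Num.sqrt a * sin p.1)).
  have -> : (fun t => Num.sqrt a * cos t) = Num.sqrt a *: @cos R by [].
  by apply: is_derive_eq; rewrite scalerN.
have yD : is_derive p.1 1 (fun t => Num.sqrt b * sin t) (Num.sqrt b * cos p.1).
  have -> : (fun t => Num.sqrt b * sin t) = Num.sqrt b *: @sin R by [].
  exact: is_derive_eq.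
have sD : derivable (fun t => - (Num.sqrt a * sin t)) p.1 1.
  have -> : (fun t => - (Num.sqrt a * sin t)) = (- Num.sqrt a) *: @sin R.
    by apply/funext => t; rewrite -mulNr.
  exact: (derivableZ (@derivable_sin R _)).
have uD : derivable (fun t => - (Num.sqrt a * sin t) / eqf a b t) p.1 1.
  exact: (derivableM sD fV).
have cD : derivable (fun t => Num.sqrt b * cos t) p.1 1.
  exact: (derivableZ (@derivable_cos R _)).
have vD : derivable (fun t => Num.sqrt b * cos t / eqf a b t) p.1 1.
  exact: (derivableM cD fV).
have dx := is_diff_comp_fst xD; have dy := is_diff_comp_fst yD.
have du := is_diff_mul_fst_snd (derivableP uD) (derivableP hD).
have dv := is_diff_mul_fst_snd (derivableP vD) (derivableP hD).
have dw := is_diff_comp_snd (derivableP wD).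
have d0 := is_diff_cst (0 : R) p.
have [dF dFE] := is_diff_pair (is_diff_pair (is_diff_pair dx dy) d0)
                              (is_diff_pair (is_diff_pair du dv) dw).
split => // X Y.
set dh := derive1 h p.2.
pose Ut := - (Num.sqrt a * sin p.1) / eqf a b p.1.
pose Vt := Num.sqrt b * cos p.1 / eqf a b p.1.
(* These three derivatives need no formula: [U'] and [V'] multiply only dt /\ dt, and [W'] is wedged
   with the differential of z, which is zero on the equator. *)
have [U' [V' [W' E]]] : exists U' V' W' : R, forall Z : R * R,
    'd (chart_lift o) p Z =
    ((Z.1 * - (Num.sqrt a * sin p.1), Z.1 * (Num.sqrt b * cos p.1), 0),
     (Ut * (Z.2 * dh) + h p.2 * (Z.1 * U'),
      Vt * (Z.2 * dh) + h p.2 * (Z.1 * V'), Z.2 * W')).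
  do 3 eexists; move=> Z; rewrite /dh derive1E; exact: (congr1 (@^~ Z) dFE).
rewrite /pullback !E /canonical_form /wedge /cx /cy /cz /=.
(* The coefficient of dh /\ dt: the velocity of the equator paired with its own unit direction,
   hence its length f. *)
have fE : - (Num.sqrt a * sin p.1) * Ut + Num.sqrt b * cos p.1 * Vt =
    eqf a b p.1.
  transitivity (eqf a b p.1 ^+ 2 / eqf a b p.1); last first.
    by rewrite expr2 mulfK.
  rewrite sqr_eqf -[X in (X * _ + _) / _](sqr_sqrtr (ltW a0)).
  by rewrite -[X in (_ + X * _) / _](sqr_sqrtr (ltW b0)) /Ut /Vt; ring.
rewrite -[in RHS]fE; ring.
Qed.

(** Differentials depend only on values near the point, so local agreement with the smooth formulas
    is enough to transfer [chart_lift_form]. *)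
Lemma chart_lift_congr (F : R * R -> vec3 R * vec3 R) (T : R * R -> R)
    (o t alpha : R) (p := (t, alpha)) :
  pi / 4 < alpha < 3 * pi / 4 ->
  (\near p, F p = chart_lift o p) ->
  (\near p, T p = o * (cos p.2 / discr p.2)) ->
  [/\ differentiable F p, differentiable T p &
      forall X Y : R * R, pullback F canonical_form p X Y =
        eqf a b t * wedge ('d T p) ('d (fun q : R * R => q.1) p) X Y].
Proof.
move=> ha nF nT.
have [dF dh formF] := @chart_lift_form o p ha.
have [FD FE] : is_diff p F ('d (chart_lift o) p).
  apply: (near_eq_is_diff (f := (chart_lift o))).
    by move: nF; apply: filterS => q ->.
  exact: differentiableP.
have [TD TE] : is_diff p T
    (fun X => X.2 * derive1 (fun al => o * (cos al / discr al)) alpha).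
  apply: (near_eq_is_diff (f := (fun q => o * (cos q.2 / discr q.2)))).
    by move: nT; apply: filterS => q ->.
  by rewrite derive1E; exact: (is_diff_comp_snd (derivableP dh)).
have [_ SE] := is_diff_fst p.
split; [exact: FD|exact: TD|move=> X Y].
by rewrite /pullback FE -/(pullback _ _ _ _ _) formF /wedge TE SE.
Qed.

End EquatorLift.

Lemma near_snd (R : realType) (P : R -> Prop) (t alpha : R) :
  (\forall x \near alpha, P x) -> \forall q \near (t, alpha), P q.2.
Proof. by move=> Pa; exact: (cvg_snd Pa). Qed.

Theorem proposition4p1 (R : realType) (a b c : R)
    (ha : 0 < a) (hb : 0 < b) (hc : 0 < c) (hab : b < a) :
  forall t alpha : R, pi / 4 < alpha < 3 * pi / 4 ->
  let J := (c * tau alpha ^+ 2 + eqf a b t ^+ 2 * (1 + tau alpha ^+ 2))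
           / (a * b * c) in
  [/\
      joachimsthal a b c (equator_point a b t)
        (normalize (equator_tangent a b t alpha)) = J,
      forall (I : set R) (g : R -> vec3 R) (s0 : R),
        timelike_geodesic a b c I g -> I s0 ->
        has_coordinates a b g s0 t alpha ->
        forall s, I s -> joachimsthal a b c (g s) (normalize (derive1 g s)) = J,
      alpha != pi / 2 ->
        let p : R * R := (t, alpha) in
        let tau_ : R * R -> R := fun q => tau q.2 in
        let t_ : R * R -> R := fun q => q.1 in
        [/\ differentiable (equator_lift a b) p,
            differentiable tau_ p &
            forall X Y : R * R,
              pullback (equator_lift a b) canonical_form p X Y
              = eqf a b t * wedge ('d tau_ p) ('d t_ p) X Y]
    &
      let p : R * R := (t, alpha) in
      let tau_ : R * R -> R := fun q => upward_tau q.2 in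
      let t_ : R * R -> R := fun q => q.1 in
      [/\ differentiable (upward_lift a b) p,
          differentiable tau_ p &
          forall X Y : R * R,
            pullback (upward_lift a b) canonical_form p X Y
            = eqf a b t * wedge ('d tau_ p) ('d t_ p) X Y]].
Proof.
move=> t alpha ht J.
have JE := joachimsthal_equator ha hb t hc ht.
have nI : \forall q \near (t, alpha), pi / 4 < q.2 < 3 * pi / 4.
  apply: (near_snd (P := fun x => is_true (pi / 4 < x < 3 * pi / 4))).
  have : alpha \in `](pi / 4), (3 * pi / 4)[ by rewrite in_itv.
  by move/near_in_itvoo; apply: filterS => x; rewrite in_itv.
split.
- exact: JE.
- move=> I g s0 geo Is0 [gs0 [k k0 dgs0]] s Is.
  (* Constancy moves the evaluation to the crossing at [s0], where the velocity is a nonzero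
     multiple of [equator_tangent]. *)
  rewrite (timelike_geodesic_joachimsthal geo Is Is0) gs0 dgs0.
  by rewrite joachimsthal_normalize_scale// mink_equator_tangent_lt0.
- move=> api /=.
  (* Off pi/2 the angle stays on one side nearby, so the sign is locally constant and can play the
     role of [o]. *)
  have nO : \forall q \near (t, alpha), orientation q.2 = orientation alpha.
    apply: (near_snd (P := fun x => orientation x = orientation alpha)).
    case: (ltgtP alpha (pi / 2)) api => // h _.
      have : alpha \in `]-oo, (pi / 2)[ by rewrite in_itv.
      move/near_in_itvNyo; apply: filterS => x; rewrite in_itv/= => xp.
      by rewrite /orientation (ltW h) (ltW xp).
    have : alpha \in `](pi / 2), +oo[ by rewrite in_itv/= h.
    move/near_in_itvoy; apply: filterS => x; rewrite in_itv/= andbT => xp.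
    by rewrite /orientation !leNgt h xp.
  apply: (chart_lift_congr ha hb (o := orientation alpha) ht).
    move: nI nO; apply: filterS2 => -[t' al] /= ht' oE.
    by rewrite equator_liftE// oE.
  move: nI nO; apply: filterS2 => -[t' al] /= ht' oE.
  by rewrite tauE// oE.
(* The upward lift and [upward_tau] follow the formulas with [o] equal to 1 on both sides of pi/2
   and at it, so no case is excluded. *)
- apply: (chart_lift_congr ha hb (o := 1) ht).
    move: nI; apply: filterS => -[t' al] /= ht'.
    by rewrite upward_liftE.
  move: nI; apply: filterS => -[t' al] /= ht'.
  by rewrite upward_tauE// mul1r.
Qed.
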